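(* For all integers $\ell\ge0$, $k\ge0$ and all $\zeta>0$, the derivative of the polynomial $P_{k+1}^{(\ell)}(x;\zeta)$ with respect to the parameter $\zeta$ satisfies $$\frac{\partial P_{k+1}^{(\ell)}}{\partial \zeta}=a_{k}^{(\ell)}P_{k}^{(\ell)}-\frac{1}{2}\left(G(\zeta)-\zeta^{-1}-b_{k+1}^{(\ell)}\right)P_{k+1}^{(\ell)}.$$
   Context: For $\zeta>0$ and an integer $\ell\ge0$, $\omega^{(\ell)}(x;\zeta)=\frac{\zeta(x^2-1)^{\ell+1/2}}{(2\ell+1)K_{2}(\zeta)}e^{-\zeta x}$ on $[1,+\infty)$, where $K_\nu$ is the modified Bessel function of the second kind, and $(f,g)_{\omega^{(\ell)}}=\int_1^\infty fg\,\omega^{(\ell)}(x;\zeta)\,dx$. $\{P_k^{(\ell)}(x;\zeta)\}_{k\ge0}$ are the orthonormal polynomials for this inner product: $\deg P_k^{(\ell)}=k$, $(P_i^{(\ell)},P_k^{(\ell)})_{\omega^{(\ell)}}=\delta_{i,k}$, with positive leading coefficient. $G(\zeta):=K_3(\zeta)/K_2(\zeta)$, $a_{k}^{(\ell)}:=(xP_{k}^{(\ell)},P_{k+1}^{(\ell)})_{\omega^{(\ell)}}$ and $b_{k}^{(\ell)}:=(xP_{k}^{(\ell)},P_{k}^{(\ell)})_{\omega^{(\ell)}}$. *)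

(* Defs.v *)
From HB Require Import structures.
From mathcomp Require Import all_boot all_order all_algebra.
From mathcomp Require Import all_classical all_reals all_analysis.
Set Implicit Arguments.
Unset Strict Implicit.
Unset Printing Implicit Defensive.
Import Order.TTheory GRing.Theory Num.Theory.
Import numFieldNormedType.Exports.
Local Open Scope classical_set_scope.
Local Open Scope ring_scope.

Definition cosh (R : realType) (y : R) : R := (expR y + expR (- y)) / 2.

(* Modified Bessel function of the second kind, through its integral
   representation K_nu(z) = int_0^oo cosh(nu t) exp(- z cosh t) dt, which is
   valid for z > 0 (for z <= 0 the value is meaningless). *)
Definition besselK (R : realType) (nu z : R) : R :=
  \int[lebesgue_measure]_(t in `[0, +oo[) (cosh (nu * t) * expR (- z * cosh t)).

Definition besselG (R : realType) (z : R) : R := besselK 3 z / besselK 2 z.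

Definition omega (R : realType) (l : nat) (z x : R) : R :=
  z * (x ^+ 2 - 1) `^ (l%:R + 2^-1) / ((2 * l%:R + 1) * besselK 2 z)
  * expR (- z * x).

(* The Lebesgue integral of a non-integrable function is a junk value; for
   z > 0 the integrand is integrable whenever f and g are polynomial. *)
Definition omega_dot (R : realType) (l : nat) (z : R) (f g : R -> R) : R :=
  \int[lebesgue_measure]_(x in `[1, +oo[) (f x * g x * omega l z x).

Definition orthonormal_polys (R : realType) (l : nat) (z : R)
    (P : nat -> {poly R}) : Prop :=
  [/\ forall k, size (P k) = k.+1,
      forall k, 0 < lead_coef (P k)
    & forall i k, omega_dot l z (horner (P i)) (horner (P k)) = (i == k)%:R].

Definition coef_a (R : realType) (P : nat -> R -> nat -> {poly R})
    (l : nat) (z : R) (k : nat) : R :=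
  omega_dot l z (fun x => x * (P l z k).[x]) (horner (P l z k.+1)).

Definition coef_b (R : realType) (P : nat -> R -> nat -> {poly R})
    (l : nat) (z : R) (k : nat) : R :=
  omega_dot l z (fun x => x * (P l z k).[x]) (horner (P l z k)).

(* Main.v *)
Require Import Defs.
From HB Require Import structures.
From mathcomp Require Import all_boot all_order all_algebra.
From mathcomp Require Import all_classical all_reals all_analysis.
From mathcomp Require Import measurable_realfun ring lra.
Import Order.TTheory GRing.Theory Num.Theory.
Import numFieldNormedType.Exports.
Local Open Scope classical_set_scope.
Local Open Scope ring_scope.

(** The weight depends on the parameter [z] only through an exponential factor
and a normalization, so its logarithmic derivative in [z] is affine in [x]:
it equals [g z - x].  Here [g z = besselG z - z^-1], because the Bessel
recurrence K_2' = (2/z) K_2 - K_3 gives the logarithmic derivative of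
z / K_2(z) ([besselK2_is_derive], [normalization_is_derive]).

Consequently the moments satisfy m_n' = g m_n - m_(n+1)
([omega_moment_is_derive]), and from there on the argument is pure algebra,
carried out in [orthonormal_poly_flow] for any family of moments with this
property.  Differentiating (P_(k+1), P_j) = delta in [z] gives

  (P_(k+1)', P_j) + (P_(k+1), P_j') + ((g - x) P_(k+1), P_j) = 0.

For j < k+1 the polynomial P_j' has degree at most j, so that orthogonality
removes the second term and the part of the third with g; there remains
(P_(k+1)', P_j) = (x P_(k+1), P_j), which is a_k for j = k and 0 for j < k.
For j = k+1 the first two terms are equal, and
(P_(k+1)', P_(k+1)) = - (g - b_(k+1)) / 2.  As P_(k+1)' has degree at most k+1,
these products determine it.

Two analytic points need care.  The P_k are only characterized by
the orthonormality conditions, so their differentiability in [z] has to be proved: the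
Gram-Schmidt formula ([gram_schmidtE]) expresses P_k through P_0, ..., P_(k-1)
and the moments, by operations that preserve differentiability
([orthonormal_poly_derivable]).  And both the moments and K_2 are integrals of
the shape of [laplace], which can be differentiated under the integral sign as
soon as they converge for every positive parameter ([laplace_is_derive]). *)

Set Implicit Arguments.
Unset Strict Implicit.
Unset Printing Implicit Defensive.

(** * Linear functionals given by their moments *)

Section MomentFunctional.
Context {R : comNzRingType}.
Implicit Types (m n : nat -> R) (p q : {poly R}).

(** The functional is defined on coefficients, so that it is linear without any
convergence condition on a measure whose moments would be [m]. *)
Definition moment_functional m p : R := \sum_(i < size p) p`_i * m i.

Lemma moment_functionalE m N p : (size p <= N)%N ->
  moment_functional m p = \sum_(i < N) p`_i * m i.
Proof.
move=> pN; rewrite /moment_functional (big_ord_widen _ (fun i => p`_i * m i) pN).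
rewrite big_mkcond; apply: eq_bigr => i _; case: ltnP => // pi.
by rewrite nth_default// mul0r.
Qed.

Lemma moment_functional_is_scalar m : scalar (moment_functional m).
Proof.
move=> a p q; set N := maxn (size p) (size q).
have pN : (size p <= N)%N by rewrite leq_maxl.
have qN : (size q <= N)%N by rewrite leq_maxr.
have sN : (size (a *: p + q)%R <= N)%N.
  rewrite (leq_trans (size_polyD _ _))// geq_max qN andbT.
  exact: leq_trans (size_scale_leq _ _) pN.
rewrite !(@moment_functionalE _ N)// mulr_sumr -big_split.
by apply: eq_bigr => i _; rewrite coefD coefZ mulrDl mulrA.
Qed.

HB.instance Definition _ m := GRing.isLinear.Build R {poly R} R _
  (moment_functional m) (moment_functional_is_scalar m).

Lemma moment_functional_shift m p :
  moment_functional (fun i => m i.+1) p = moment_functional m ('X * p).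
Proof.
have sXp : (size ('X * p)%R <= (size p).+1)%N.
  by rewrite (leq_trans (size_polyMleq _ _))// size_polyX.
rewrite (moment_functionalE _ sXp) big_ord_recl coefXM mul0r add0r.
by apply: eq_bigr => i _; rewrite coefXM.
Qed.

Lemma moment_functionalB m n p a :
  moment_functional (fun i => a * m i - n i) p =
  a * moment_functional m p - moment_functional n p.
Proof.
rewrite /moment_functional mulr_sumr -sumrB.
by apply: eq_bigr => i _; rewrite mulrBr mulrCA.
Qed.

End MomentFunctional.

(** * Orthonormal polynomials and the Gram-Schmidt formula *)

Section OrthonormalFamily.
Context {R : rcfType} (L : {scalar {poly R}}) (P : nat -> {poly R}).

Definition orthonormal_family :=
  [/\ forall k, size (P k) = k.+1, forall k, 0 < lead_coef (P k)
    & forall i k, L (P i * P k) = (i == k)%:R].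

Hypothesis oP : orthonormal_family.

Lemma orthonormal_split k (q : {poly R}) : (size q <= k.+1)%N ->
  exists2 r : {poly R}, (size r <= k)%N & q = (q`_k / lead_coef (P k)) *: P k + r.
Proof.
case: oP => sP lP _ sq.
exists (q - (q`_k / lead_coef (P k)) *: P k); last by rewrite addrC subrK.
apply/leq_sizeP => j; rewrite leq_eqVlt => /predU1P[<-|kj].
  have -> : lead_coef (P k) = (P k)`_k by rewrite lead_coefE sP.
  rewrite coefB coefZ divfK ?subrr//.
  by move: (lP k); rewrite lead_coefE sP => /lt0r_neq0.
rewrite coefB coefZ [q`_j]nth_default ?(leq_trans sq)//.
by rewrite [(P k)`_j]nth_default ?sP// mulr0 subrr.
Qed.

(** [q] is a combination of the [P j] with [j < k], which is seen by peeling off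
leading coefficients. *)
Lemma orthonormal_lower k (q : {poly R}) : (size q <= k)%N -> L (P k * q) = 0.
Proof.
case: oP => sP lP LP.
suff H n (q' : {poly R}) : (n <= k)%N -> (size q' <= n)%N -> L (P k * q') = 0.
  exact: (H k).
elim: n q' => [|n IH] {}q nk sq.
  by move: sq; rewrite leqn0 size_poly_eq0 => /eqP ->; rewrite mulr0 linear0.
have [r sr ->] := orthonormal_split sq.
rewrite mulrDr -scalerAr linearD linearZ /= LP IH// ?(ltnW nk)//.
by rewrite gtn_eqF// mulr0 addr0.
Qed.

(** If [q] had degree [j], pairing it with [P j] would single out the ratio of the
leading coefficients of [q] and [P j], which is not zero. *)
Lemma orthonormal_eq0 k (q : {poly R}) : (size q <= k)%N ->
  (forall j, (j < k)%N -> L (P j * q) = 0) -> q = 0.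
Proof.
case: oP => sP lP LP sq Lq; apply/eqP; apply: contraT => q0.
have sq0 : (0 < size q)%N by rewrite size_poly_gt0.
have sq1 : (size q <= (size q).-1.+1)%N by rewrite prednK.
have [r sr qE] := orthonormal_split sq1.
have := Lq (size q).-1; rewrite prednK// => /(_ sq).
rewrite {2}qE mulrDr -scalerAr linearD linearZ /= LP eqxx mulr1.
rewrite orthonormal_lower// addr0 => /eqP.
rewrite mulf_eq0 invr_eq0 -/(lead_coef q) lead_coef_eq0 (negPf q0)/=.
by rewrite gt_eqF.
Qed.

Definition gram_schmidt k : {poly R} :=
  'X^k - \sum_(j < k) L ('X^k * P j) *: P j.

(** [P k] and the monic polynomial [gram_schmidt k] are both orthogonal to the
lower [P j], hence proportional; the positive factor is fixed by the norm.
This determines [P k] from the lower [P j] and the functional alone. *)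
Lemma gram_schmidtE k : 0 < L (gram_schmidt k * gram_schmidt k) /\
  P k = (Num.sqrt (L (gram_schmidt k * gram_schmidt k)))^-1 *: gram_schmidt k.
Proof.
case: (oP) => sP lP LP; set Q := gram_schmidt k.
have ss : (size (\sum_(j < k) L ('X^k * P j) *: P j)%R <= k)%N.
  apply/leq_sizeP => i ki; rewrite coef_sum big1// => j _.
  by rewrite coefZ [(P j)`_i]nth_default ?mulr0// sP (leq_trans _ ki).
have QC i : (k <= i)%N -> Q`_i = (i == k)%:R.
  by move=> ki; rewrite coefB coefXn [X in _ - X]nth_default ?subr0// (leq_trans ss).
have LQ j : (j < k)%N -> L (P j * Q) = 0.
  move=> jk; rewrite mulrBr linearB/= mulr_sumr linear_sum/=.
  rewrite (bigD1 (Ordinal jk))//= -scalerAr linearZ/= LP eqxx mulr1.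
  rewrite mulrC big1 ?addr0 ?subrr// => i ij.
  rewrite -scalerAr linearZ/= LP -[j]/(nat_of_ord (Ordinal jk)).
  by rewrite (inj_eq val_inj) eq_sym (negPf ij) mulr0.
have lk : lead_coef (P k) = (P k)`_k by rewrite lead_coefE sP.
have PQ : P k = lead_coef (P k) *: Q.
  apply/eqP; rewrite -subr_eq0; apply/eqP; apply: (@orthonormal_eq0 k).
    apply/leq_sizeP => i ki; rewrite coefB coefZ QC// lk.
    move: ki; rewrite leq_eqVlt => /predU1P[<-|ki]; first by rewrite eqxx mulr1 subrr.
    by rewrite gtn_eqF// mulr0 subr0 nth_default// sP.
  move=> j jk; rewrite mulrBr linearB/= LP ltn_eqF// -scalerAr linearZ/= LQ//.
  by rewrite mulr0 subr0.
have l0 := lP k; set l := lead_coef _ in PQ l0.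
have LQQ : l ^+ 2 * L (Q * Q) = 1.
  have /(congr1 L) : P k * P k = l ^+ 2 *: (Q * Q).
    by rewrite PQ -scalerAl -scalerAr scalerA.
  by rewrite LP eqxx linearZ/=.
have -> : L (Q * Q) = l^-1 ^+ 2.
  apply: (mulfI (_ : l ^+ 2 != 0)); first by rewrite expf_neq0// gt_eqF.
  by rewrite LQQ -exprMn divff ?expr1n// gt_eqF.
by rewrite sqrtr_sqr gtr0_norm ?invr_gt0// exprn_gt0 ?invr_gt0// invrK.
Qed.

End OrthonormalFamily.

(** * Polynomials whose coefficients depend on a parameter *)

Section PolynomialDerivative.
Context {R : realType}.
Implicit Types (p q : R -> {poly R}) (u : R -> R).

(** The degree bound near [z] is what makes evaluation and moment functionals
finite sums of a fixed length. *)
Definition poly_is_derive (z : R) p (p' : {poly R}) :=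
  (exists N, \forall s \near z, (size (p s) <= N)%N) /\
  forall i, is_derive z 1 (fun s => (p s)`_i) p'`_i.

Lemma poly_is_derive_size (z : R) p (p' : {poly R}) N : poly_is_derive z p p' ->
  (\forall s \near z, size (p s) <= N)%N -> (size p' <= N)%N.
Proof.
move=> [_ dp] pN; apply/leq_sizeP => j Nj.
have [_ <-] := dp j.
rewrite -[RHS](derive_cst (0 : R) z (1 : R)); apply: near_eq_derive.
by apply: filterS pN => s sN; rewrite nth_default// (leq_trans sN).
Qed.

Lemma poly_is_derive_near (z : R) p q (p' : {poly R}) :
  (\forall s \near z, p s = q s) -> poly_is_derive z p p' ->
  poly_is_derive z q p'.
Proof.
move=> pq [[N pN] dp]; split; first by exists N; apply: filterS2 pq pN => s ->.
by move=> i; apply: near_eq_is_derive (dp i); apply: filterS pq => s ->.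
Qed.

Lemma poly_is_derive_cst (z : R) (p : {poly R}) : poly_is_derive z (fun=> p) 0.
Proof.
split; first by exists (size p); near=> s.
move=> i; rewrite coef0; exact: is_derive_cst.
Unshelve. all: by end_near. Qed.

Lemma poly_is_deriveC (z : R) u (u' : R) : is_derive z 1 u u' ->
  poly_is_derive z (fun s => (u s)%:P) u'%:P.
Proof.
move=> du; split; first by exists 1%N; near=> s; exact: size_polyC_leq1.
move=> [|i]; rewrite coefC/=; last first.
  by under eq_fun do rewrite coefC/=; exact: is_derive_cst.
by under eq_fun do rewrite coefC/=.
Unshelve. all: by end_near. Qed.

Lemma poly_is_deriveD (z : R) p q (p' q' : {poly R}) : poly_is_derive z p p' ->
  poly_is_derive z q q' -> poly_is_derive z (fun s => p s + q s) (p' + q').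
Proof.
move=> [[M pM] dp] [[N qN] dq]; split.
  exists (maxn M N); apply: filterS2 pM qN => s pM qN.
  by rewrite (leq_trans (size_polyD _ _))// geq_max !leq_max pM qN orbT.
move=> i; rewrite coefD.
rewrite [X in is_derive _ _ X _](_ : _ = (fun s => (p s)`_i) + (fun s => (q s)`_i)).
  exact: is_deriveD.
by apply/funext => s; rewrite coefD.
Qed.

Lemma poly_is_deriveM (z : R) p q (p' q' : {poly R}) : poly_is_derive z p p' ->
  poly_is_derive z q q' ->
  poly_is_derive z (fun s => p s * q s) (p z * q' + q z * p').
Proof.
move=> [[M pM] dp] [[N qN] dq]; split.
  exists (M + N)%N; apply: filterS2 pM qN => s pM qN.
  by rewrite (leq_trans (size_polyMleq _ _))// (leq_trans (leq_pred _))// leq_add.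
move=> i; rewrite coefD coefM (mulrC (q z)) coefM -big_split/=.
rewrite [X in is_derive _ _ X _](_ : _ =
    \sum_(j < i.+1) ((fun s => (p s)`_j) * (fun s => (q s)`_(i - j)))).
  apply: is_derive_sum => j.
  apply: is_derive_eq (is_deriveM (dp j) (dq (i - j)%N)) _.
  by congr (_ + _); exact: mulrC.
by apply/funext => s; rewrite coefM fct_sumE.
Qed.

Lemma poly_is_deriveZ (z : R) u p (u' : R) (p' : {poly R}) :
  is_derive z 1 u u' -> poly_is_derive z p p' ->
  poly_is_derive z (fun s => u s *: p s) (u z *: p' + u' *: p z).
Proof.
move=> /poly_is_deriveC du dp; rewrite -!mul_polyC [u'%:P * _]mulrC.
by under eq_fun do rewrite -mul_polyC; exact: poly_is_deriveM.
Qed.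

Lemma poly_is_derive_sum (z : R) n (p : 'I_n -> R -> {poly R}) (p' : 'I_n -> {poly R}) :
  (forall j, poly_is_derive z (p j) (p' j)) ->
  poly_is_derive z (fun s => \sum_(j < n) p j s) (\sum_(j < n) p' j).
Proof.
elim: n p p' => [|n IH] p p' dp.
  by rewrite big_ord0; under eq_fun do rewrite big_ord0; exact: poly_is_derive_cst.
rewrite big_ord_recl; under eq_fun do rewrite big_ord_recl.
by apply: poly_is_deriveD => //; apply: IH.
Qed.

Lemma poly_is_derive_horner (z : R) p (p' : {poly R}) x : poly_is_derive z p p' ->
  is_derive z 1 (fun s => (p s).[x]) p'.[x].
Proof.
move=> pp'; have [[M pM] dp] := pp'.
rewrite (horner_coef_wide _ (poly_is_derive_size pp' pM)).
apply: (@near_eq_is_derive _ _ _ (\sum_(j < M) (x ^+ j \*: (fun s => (p s)`_j)))).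
  apply: filterS pM => s pM; rewrite fct_sumE (horner_coef_wide _ pM).
  by apply: eq_bigr => j _; rewrite mulrC.
by apply: is_derive_sum => j; rewrite mulrC; exact: is_deriveZ.
Qed.

Lemma moment_functional_is_derive (z : R) (m : R -> nat -> R) (m' : nat -> R) p (p' : {poly R}) :
  (forall i, is_derive z 1 (m ^~ i) (m' i)) -> poly_is_derive z p p' ->
  is_derive z 1 (fun s => moment_functional (m s) (p s))
    (moment_functional m' (p z) + moment_functional (m z) p').
Proof.
move=> dm pp'; have [[M pM] dp] := pp'.
rewrite (moment_functionalE _ (poly_is_derive_size pp' pM)).
rewrite (moment_functionalE _ (nbhs_singleton pM)) -big_split/=.
apply: (@near_eq_is_derive _ _ _ (\sum_(j < M) ((fun s => (p s)`_j) * (m ^~ j)))).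
  by apply: filterS pM => s pM; rewrite fct_sumE (moment_functionalE _ pM).
apply: is_derive_sum => j.
apply: is_derive_eq (is_deriveM (dp j) (dm j)) _.
by congr (_ + _); exact: mulrC.
Qed.

End PolynomialDerivative.

(** * Orthonormal polynomials under an exponential change of the weight *)

Section ExponentialFlow.
Context {R : realType} (m : R -> nat -> R) (g : R -> R) (P : R -> nat -> {poly R}).
Local Notation L s := (moment_functional (m s)).
Hypothesis dm : forall z : R, 0 < z -> forall i,
  is_derive z 1 (m ^~ i) (g z * m z i - m z i.+1).
Hypothesis oP : forall z : R, 0 < z -> orthonormal_family (L z) (P z).

(** When the [m z] are the moments of a weight with logarithmic derivative
[g z - x] in [z], this is differentiation under the integral sign. *)
Lemma flow_is_derive (z : R) p (p' : {poly R}) : 0 < z -> poly_is_derive z p p' ->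
  is_derive z 1 (fun s => L s (p s))
    (g z * L z (p z) - L z ('X * p z) + L z p').
Proof.
move=> z0 dp; have := moment_functional_is_derive (dm z0) dp.
by rewrite moment_functionalB moment_functional_shift.
Qed.

(** By [gram_schmidtE], [P s k] is obtained from the lower [P s j] and the moments by
sums, products and the inverse square root of a positive quantity. *)
Lemma orthonormal_poly_derivable k (z : R) : 0 < z ->
  exists p', poly_is_derive z (P ^~ k) p'.
Proof.
elim/ltn_ind: k z => k IH z z0.
have [Q' dQ] : exists Q', poly_is_derive z (fun s => gram_schmidt (L s) (P s) k) Q'.
  have dj (j : 'I_k) : exists r', poly_is_derive z
      (fun s => - L s ('X^k * P s j) *: P s j) r'.
    have [p' dp] := IH j (ltn_ord j) z z0.
    have dXp := poly_is_deriveM (poly_is_derive_cst z 'X^k) dp.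
    have dL := is_deriveN (flow_is_derive z0 dXp).
    by eexists; exact: poly_is_deriveZ dL dp.
  pose r' j := projT1 (cid (dj j)).
  exists (0 + \sum_(j < k) r' j); rewrite /gram_schmidt.
  under eq_fun do rewrite -sumrN.
  apply: poly_is_deriveD; first exact: poly_is_derive_cst.
  apply: poly_is_derive_sum => j.
  by under eq_fun do rewrite -scaleNr; exact: (projT2 (cid (dj j))).
have [LQ0 _] := gram_schmidtE (oP z0) k.
have dLQ := flow_is_derive z0 (poly_is_deriveM dQ dQ).
have dS := is_derive1_comp (is_derive1_sqrt LQ0) dLQ.
have S0 : (Num.sqrt \o fun s => L s (gram_schmidt (L s) (P s) k *
    gram_schmidt (L s) (P s) k)) z != 0 by rewrite /= gt_eqF// sqrtr_gt0.
have dV := is_deriveV S0 dS.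
eexists; apply: poly_is_derive_near (poly_is_deriveZ dV dQ).
have : \forall s \near z, 0 < s by exact: lt_nbhsr.
by apply: filterS => s s0; have [_ ->] := gram_schmidtE (oP s0) k.
Qed.

Lemma orthonormal_poly_flow k (z : R) : 0 < z ->
  poly_is_derive z (P ^~ k.+1)
    (L z ('X * P z k * P z k.+1) *: P z k
     - (2^-1 * (g z - L z ('X * P z k.+1 * P z k.+1))) *: P z k.+1).
Proof.
move=> z0; have [p' dp] := orthonormal_poly_derivable k.+1 z0.
have [sP lP LP] := oP z0.
set rhs := (X in poly_is_derive _ _ X); suff <- : p' = rhs by [].
have near_pos : \forall s \near z, 0 < s by exact: lt_nbhsr.
have sp' i q' : poly_is_derive z (P ^~ i) q' -> (size q' <= i.+1)%N.
  move=> dq; apply: poly_is_derive_size dq _.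
  by apply: filterS near_pos => s s0; have [-> _ _] := oP s0.
apply/eqP; rewrite -subr_eq0; apply/eqP; apply: (@orthonormal_eq0 _ (L z) _ (oP z0) k.+2).
  rewrite (leq_trans (size_polyD _ _))// geq_max sp'//= size_polyN.
  rewrite (leq_trans (size_polyD _ _))// geq_max size_polyN.
  by rewrite !(leq_trans (size_scale_leq _ _)) ?sP.
(* The inner products of the [P s i] are constant on [0 < s]. *)
have Leibniz i q' : poly_is_derive z (P ^~ i) q' ->
    g z * (k.+1 == i)%:R - L z ('X * (P z k.+1 * P z i))
    + (L z (P z k.+1 * q') + L z (P z i * p')) = 0.
  move=> dq; have [_] := flow_is_derive z0 (poly_is_deriveM dp dq).
  rewrite linearD/= LP => <-; rewrite -[RHS](derive_cst ((k.+1 == i)%:R : R) z (1 : R)).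
  apply: near_eq_derive.
  by apply: filterS near_pos => s s0; have [_ _ ->] := oP s0.
have Lrhs (a c : R) i : L z (P z i * (a *: P z k - c *: P z k.+1)) =
    a * (i == k)%:R - c * (i == k.+1)%:R.
  by rewrite mulrBr linearB/= -!scalerAr !linearZ/= !LP.
move=> j; rewrite ltnS leq_eqVlt mulrBr linearB/= Lrhs => /predU1P[->|jk].
  have := Leibniz _ _ dp; rewrite eqxx gtn_eqF// mulr0 !mulr1 mulrA.
  by set a := L z (_ * p'); set b := L z _; lra.
have [q' dq] := orthonormal_poly_derivable j z0.
have := Leibniz _ _ dq.
rewrite orthonormal_lower ?(leq_trans (sp' _ _ dq))// gtn_eqF//.
rewrite (ltn_eqF jk) !mulr0 !add0r subr0.
move: jk; rewrite ltnS leq_eqVlt => /predU1P[->|jk].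
  rewrite eqxx !mulr1 mulrA [_ * P z k]mulrAC.
  by set a := L z (_ * p'); set b := L z _; lra.
rewrite mulrCA orthonormal_lower//; last first.
  by rewrite (leq_trans (size_polyMleq _ _))// size_polyX sP.
by rewrite (ltn_eqF jk) mulr0 subr0 oppr0 add0r.
Qed.

End ExponentialFlow.

(** * Integrals of Laplace type *)

Section LaplaceIntegral.
Context {R : realType} {d : measure_display} {T : measurableType d}.
Context {mu : {measure set T -> \bar R}} {D : set T} (mD : measurable D).
Context {h : T -> R} (mh : measurable_fun D h) (h0 : forall t, D t -> 0 <= h t).
Implicit Types f g : T -> R.

Definition laplace f z : R := \int[mu]_(t in D) (f t * expR (- z * h t)).

(** Asking for all [z > 0] at once makes the class stable under multiplication by
[h]: the factor [h] is absorbed by half of the exponential decay. *)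
Definition laplace_integrable f := forall z, 0 < z ->
  mu.-integrable D (EFin \o (fun t => f t * expR (- z * h t))).

Lemma laplace_measurable z : measurable_fun D (fun t => expR (- z * h t)).
Proof.
apply: measurableT_comp => //; apply: measurable_funM => //.
Qed.

Lemma laplace_integrable_le f g (a : R) : measurable_fun D g ->
  (forall t, D t -> `|g t| <= a * `|f t|) ->
  laplace_integrable f -> laplace_integrable g.
Proof.
move=> mg gf lf z z0; have /(integrableZl mD a) := lf z z0.
apply: le_integrable => //.
  by apply/measurable_EFinP; apply: measurable_funM => //; exact: laplace_measurable.
move=> t Dt; rewrite /= lee_fin !normrM mulrA.
rewrite ler_wpM2r// (le_trans (gf _ Dt))// ler_wpM2r//; exact: ler_norm.
Qed.

(** This is [y * (z / 2) <= expR (y * (z / 2))]. *)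
Lemma mul_exp_le (z y : R) : 0 < z -> 0 <= y ->
  y * expR (- z * y) <= 2 / z * expR (- (z / 2) * y).
Proof.
move=> z0 y0.
have -> : - z * y = - (z / 2) * y + - (z / 2) * y by field.
rewrite expRD mulrA ler_wpM2r ?expR_ge0//.
have : expR (- (z / 2) * y) * (z / 2 * y) <= 1.
  rewrite mulNr expRN ler_pdivrMl ?expR_gt0// mulr1.
  by apply: le_trans (expR_ge1Dx _); rewrite lerDr.
rewrite mulrCA -ler_pdivlMl ?divr_gt0// mulr1 invf_div => H.
by rewrite mulrC.
Qed.

Lemma laplace_integrableM f : laplace_integrable f ->
  laplace_integrable (fun t => f t * h t).
Proof.
move=> lf z z0; have z20 : 0 < z / 2 by rewrite divr_gt0.
have /(integrableZl mD (2 / z)) := lf _ z20.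
apply: le_integrable => //.
  under eq_fun do rewrite mulrAC.
  apply/measurable_EFinP; apply: measurable_funM => //.
  by have /integrableP[/measurable_EFinP] := lf _ z0.
move=> t Dt; rewrite /= lee_fin -mulrA [2 / z * _]mulrCA !(normrM (f t)) ler_wpM2l//.
rewrite !ger0_norm ?mulr_ge0 ?expR_ge0 ?h0 ?invr_ge0 ?(ltW z0)//.
exact: mul_exp_le (h0 Dt).
Qed.

Lemma laplace_integrableX f n : laplace_integrable f ->
  laplace_integrable (fun t => f t * h t ^+ n).
Proof.
move=> lf; elim: n => [|n IH].
  by under eq_fun do rewrite expr0 mulr1.
by under eq_fun do rewrite exprSr mulrA; exact: laplace_integrableM.
Qed.

(** For [s] near [z], say [z / 2 < s], the derivative of the integrand is dominated
by its absolute value at [z / 2]. *)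
Lemma laplace_is_derive f (z : R) : laplace_integrable f -> 0 < z ->
  is_derive z 1 (laplace f) (- laplace (fun t => f t * h t) z).
Proof.
move=> lf z0; have z20 : 0 < z / 2 by rewrite divr_gt0.
have dF (x : R) t : is_derive x 1 (fun s => f t * expR (- s * h t))
    (- (f t * h t * expR (- x * h t))).
  apply: is_derive_eq; rewrite /= ?scaler0 ?addr0 ?add0r.
  by rewrite /GRing.scale/=; ring.
have Iz : (`]z / 2, z + 1[)%classic z.
  by rewrite /= in_itv/= ltrDl ltr01 ltr_pdivrMr// ltr_pMr// ltr1n.
have intf (x : R) : (`]z / 2, z + 1[)%classic x ->
    mu.-integrable D (EFin \o (fun t => f t * expR (- x * h t))).
  by rewrite /= in_itv/= => /andP[zx _]; exact/lf/(lt_trans z20).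
have intG : mu.-integrable D (EFin \o (fun t => `|f t * h t * expR (- (z / 2) * h t)|)).
  exact/integrable_norm/laplace_integrableM.
have derf (x : R) t : (`]z / 2, z + 1[)%classic x -> D t ->
  derivable (fun s : R => f t * expR (- s * h t)) x 1 by move=> _ _; have [] := dF x t.
have d1 (x : R) t : partial1of2 (fun (s : R) t => f t * expR (- s * h t)) x t =
    - (f t * h t * expR (- x * h t)).
  by rewrite partial1of2E; have [] := dF x t.
have ub (x : R) t : (`]z / 2, z + 1[)%classic x -> D t ->
    `|partial1of2 (fun (s : R) t => f t * expR (- s * h t)) x t| <=
    `|f t * h t * expR (- (z / 2) * h t)|.
  rewrite /= in_itv/= => /andP[zx _] Dt.
  rewrite d1 normrN !normrM ler_wpM2l// !ger0_norm ?expR_ge0// ler_expR.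
  by rewrite ler_wpM2r ?h0// lerN2 ltW.
apply: DeriveDef.
  exact: (derivable_under_integral mD Iz intf derf (fun=> normr_ge0 _) intG ub).
rewrite -derive1E (differentiation_under_integral mD Iz intf derf (fun=> normr_ge0 _) intG ub).
under eq_Rintegral do rewrite d1 -mulN1r.
rewrite RintegralZl ?mulN1r//.
exact: laplace_integrableM.
Qed.

End LaplaceIntegral.

(** * Integrals over a half-line *)

Section HalfLine.
Context {R : realType}.
Local Notation mu := (@lebesgue_measure R).

Lemma laplace_integrable1 (a : R) : 0 <= a ->
  @laplace_integrable R _ _ mu `[a, +oo[%classic id (fun=> 1).
Proof.
move=> a0 z z0.
have ia : mu.-integrable `[a, +oo[ (EFin \o exponential_pdf z).
  by apply: integrableS (integrable_exponential_pdf z0) => //.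
have : mu.-integrable `[a, +oo[ (fun t => (z^-1)%:E * (EFin \o exponential_pdf z) t)%E.
  exact: integrableZl.
apply: eq_integrable => // t; rewrite inE/= in_itv/= andbT => ta.
rewrite /exponential_pdf patchE ifT; last first.
  by rewrite inE/= in_itv/= andbT (le_trans a0).
by rewrite -EFinM mulrA mulVf ?gt_eqF.
Qed.

Lemma is_derive_continuous (G g : R -> R) :
  (forall t : R, is_derive t 1 G (g t)) -> continuous G.
Proof.
move=> dG t; apply: differentiable_continuous; apply/derivable1_diffP.
by have [] := dG t.
Qed.

(** The integrand [f] may change sign, whereas the fundamental theorem of calculus
on a half-line asks for a nonnegative one.  Adding [C * expR (- t)] makes it
nonnegative, and this correction has an explicit integral. *)
Lemma integral_is_derive_halfline (F f : R -> R) (C : R) :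
  (forall t : R, is_derive t 1 F (f t)) -> continuous f ->
  (forall t, 0 <= t -> `|F t| <= C * expR (- t)) ->
  (forall t, 0 <= t -> `|f t| <= C * expR (- t)) ->
  \int[mu]_(t in `[0, +oo[) f t = - F 0.
Proof.
move=> dF cf FC fC.
have C0 : 0 <= C.
  by have := fC 0 (lexx 0); rewrite oppr0 expR0 mulr1; apply: le_trans.
have dE (t : R) : is_derive t 1 (fun t => - (C * expR (- t))) (C * expR (- t)).
  by apply: is_derive_eq; rewrite /GRing.scale/=; ring.
have cE : continuous (fun t : R => C * expR (- t)).
  apply: (@is_derive_continuous (fun t => C * expR (- t))
    (fun t => - (C * expR (- t)))) => t.
  by apply: is_derive_eq; rewrite /GRing.scale/=; ring.
have E0 : - (C * expR (- t)) @[t --> +oo%R] --> (0 : R).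
  by rewrite -oppr0 -(mulr0 C); apply: cvgN; apply: cvgMr; exact: cvgr_expR.
have EFT (G g : R -> R) : (forall t, 0 <= t -> 0 <= g t) -> continuous g ->
    (forall t : R, is_derive t 1 G (g t)) -> G t @[t --> +oo%R] --> (0 : R) ->
    \int[mu]_(t in `[0, +oo[) g t = - G 0.
  move=> g0 cg dG G0; rewrite (Rintegral_ge0_continuous_FTC2y g0 _ G0) ?sub0r//.
  - by apply: continuous_subspaceT.
  - apply: cvg_at_right_filter; exact: (is_derive_continuous dG).
  - by move=> t _; rewrite derive1E; have [] := dG t.
have iE : mu.-integrable `[0, +oo[ (EFin \o (fun t : R => C * expR (- t))).
  have i1 := laplace_integrable1 (lexx 0) (@ltr01 R).
  have : mu.-integrable `[0, +oo[ (fun t : R =>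
      C%:E * (EFin \o (fun t => 1 * expR (- 1 * id t))%R) t)%E by exact: integrableZl.
  by apply: eq_integrable => // t _; rewrite /= -EFinM mul1r mulN1r.
have if_ : mu.-integrable `[0, +oo[ (EFin \o f).
  apply: le_integrable iE => //.
    apply/measurable_EFinP; apply: measurable_funTS.
    exact: continuous_measurable_fun.
  move=> t; rewrite /= in_itv/= andbT => t0; rewrite lee_fin.
  by rewrite (le_trans (fC t t0))// ler_norm.
have := EFT (fun t => F t - C * expR (- t)) (fun t => f t + C * expR (- t)).
have := EFT _ _ _ cE dE E0.
rewrite RintegralD// oppr0 expR0 mulr1 opprK => -> //; last first.
  by move=> t _; rewrite mulr_ge0// expR_ge0.
move=> H; apply: (addIr C); rewrite H ?opprB 1?addrC//.
- move=> t t0; have := fC t t0; rewrite ler_norml => /andP[+ _].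
  by rewrite -subr_ge0 opprK.
- by move=> t; apply: cvgD; [exact: cf|exact: cE].
have F0 : F t @[t --> +oo%R] --> (0 : R); last first.
  by rewrite -[X in _ --> X]addr0; apply: cvgD.
apply: norm_cvg0.
apply: (@squeeze_cvgr _ _ _ _ (cst 0) (fun t => C * expR (- t))).
- near=> t; rewrite normr_ge0/= FC//; near: t; exact: nbhs_pinfty_ge.
- exact: cvg_cst.
- by rewrite -(mulr0 C); apply: cvgMr; exact: cvgr_expR.
Unshelve. all: by end_near. Qed.

End HalfLine.

(** * The derivative of the Bessel function of order two *)

Section BesselDerivative.
Context {R : realType}.
Local Notation mu := (@lebesgue_measure R).
Local Notation coshint := (@laplace_integrable R _ _ mu `[0, +oo[%classic (@cosh R)).
Implicit Types t z : R.

Definition sinh t : R := (expR t - expR (- t)) / 2.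

Lemma cosh_is_derive t : is_derive t 1 (@cosh R) (sinh t).
Proof.
rewrite /cosh; apply: is_derive_eq; rewrite /GRing.scale/= /sinh; ring.
Qed.

Lemma sinh_is_derive t : is_derive t 1 sinh (cosh t).
Proof.
rewrite /sinh; apply: is_derive_eq; rewrite /GRing.scale/= /cosh; ring.
Qed.

Lemma expRNM t : expR (- t) * expR t = 1.
Proof. by rewrite -expRD addNr expR0. Qed.

Lemma cosh2_sinh2 t : cosh t ^+ 2 - sinh t ^+ 2 = 1.
Proof. by rewrite -(expRNM t) /cosh /sinh; field. Qed.

Lemma cosh_double t : cosh (2 * t) = 2 * cosh t ^+ 2 - 1.
Proof.
rewrite /cosh -mulrN !(expRM_natl 2); have := expRNM t.
set u := expR t; set v := expR _; lra.
Qed.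

Lemma cosh_triple t : cosh (3 * t) = 4 * cosh t ^+ 3 - 3 * cosh t.
Proof.
rewrite /cosh -mulrN !(expRM_natl 3).
have := congr1 (fun x => x * (expR t + expR (- t))) (expRNM t).
by set u := expR t; set v := expR _; rewrite mul1r; lra.
Qed.

Lemma cosh_ge1 t : 1 <= cosh t.
Proof.
by rewrite /cosh; have := expR_ge1Dx t; have := expR_ge1Dx (- t); lra.
Qed.

Lemma cosh_ge_expR t : expR t <= 2 * cosh t.
Proof. by rewrite /cosh mulrC divfK// lerDl expR_ge0. Qed.

Lemma cosh_continuous : continuous (@cosh R).
Proof. exact: is_derive_continuous cosh_is_derive. Qed.

Lemma cosh_measurable (D : set R) : measurable_fun D (@cosh R).
Proof.
by apply: measurable_funTS; apply: continuous_measurable_fun; exact: cosh_continuous.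
Qed.

Lemma cosh_laplace_integrable n : coshint (fun t => cosh t ^+ n).
Proof.
rewrite (_ : (fun t => _) = (fun t => 1 * cosh t ^+ n)); last first.
  by apply/funext => t; rewrite mul1r.
apply: laplace_integrableX => //; first exact: cosh_measurable.
  by move=> t _; rewrite (le_trans _ (cosh_ge1 t)).
move=> z z0; have z20 : 0 < z / 2 by rewrite divr_gt0.
have := laplace_integrable1 (lexx 0) z20.
apply: le_integrable => //.
  apply/measurable_EFinP; apply: measurable_funM => //.
  by apply: laplace_measurable => //; exact: cosh_measurable.
move=> t; rewrite /= in_itv/= andbT => t0; rewrite lee_fin !mul1r.
rewrite !ger0_norm ?expR_ge0// ler_expR !mulNr lerN2 -mulrA ler_pM2l//.
have := cosh_ge_expR t; have := expR_ge1Dx t; lra.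
Qed.

(** The exponential absorbs [n + 1] powers of [cosh t]; the spare one leaves the
factor [(cosh t)^-1 <= 2 * expR (- t)]. *)
Lemma cosh_expR_le z t n : 0 < z -> 0 <= t ->
  cosh t ^+ n * expR (- z * cosh t) <= n.+1`!%:R / z ^+ n.+1 * 2 * expR (- t).
Proof.
move=> z0 t0; have c1 := cosh_ge1 t; have c0 : 0 < cosh t by apply: lt_le_trans c1.
have zc0 : 0 <= z * cosh t by rewrite mulr_ge0// ltW.
have H : (z * cosh t) ^+ n.+1 * expR (- z * cosh t) <= n.+1`!%:R.
  rewrite mulNr expRN ler_pdivrMr ?expR_gt0//.
  rewrite [_ * expR _]mulrC -ler_pdivrMr ?ltr0n ?fact_gt0//.
  by rewrite (le_trans _ (expR_ge1Dxn n zc0))// lerDr.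
have {}H : cosh t ^+ n * expR (- z * cosh t) <= n.+1`!%:R / z ^+ n.+1 / cosh t.
  rewrite ler_pdivlMr// ler_pdivlMr ?exprn_gt0//; apply: le_trans H.
  by rewrite (exprMn _ z) (exprSr (cosh t)) le_eqVlt; apply/orP; left; apply/eqP; ring.
apply: le_trans H _; rewrite -[leRHS]mulrA ler_wpM2l//.
  by rewrite divr_ge0// exprn_ge0// ltW.
by rewrite expRN ler_pdivlMr ?expR_gt0// mulrC ler_pdivrMr// cosh_ge_expR.
Qed.

Lemma besselK_laplace nu z :
  besselK nu z = @laplace R _ _ mu `[0, +oo[%classic (@cosh R) (fun t => cosh (nu * t)) z.
Proof. by []. Qed.

Lemma cosh2_laplace_integrable : coshint (fun t => cosh (2 * t)).
Proof.
apply: (laplace_integrable_le (a := 2) _ _ _ _ (cosh_laplace_integrable 2)) => //.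
- exact: cosh_measurable.
- by apply: measurableT_comp => //; exact: cosh_measurable.
move=> t _; have c1 := cosh_ge1 t; rewrite cosh_double normrX !ger0_norm; nra.
Qed.

Lemma cosh3_laplace_integrable : coshint (fun t => cosh (3 * t)).
Proof.
apply: (laplace_integrable_le (a := 4) _ _ _ _ (cosh_laplace_integrable 3)) => //.
- exact: cosh_measurable.
- by apply: measurableT_comp => //; exact: cosh_measurable.
move=> t _; have c1 := cosh_ge1 t; rewrite cosh_triple normrX.
have c3 : cosh t <= cosh t ^+ 3 by rewrite exprS ler_peMr ?exprn_ege1//; lra.
rewrite (ger0_norm (_ : 0 <= cosh t)); last lra.
rewrite ger0_norm; lra.
Qed.

Lemma cosh2M_laplace_integrable : coshint (fun t => cosh (2 * t) * cosh t).
Proof.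
apply: laplace_integrableM cosh2_laplace_integrable => //; first exact: cosh_measurable.
by move=> t _; rewrite (le_trans _ (cosh_ge1 t)).
Qed.

(** Integration by parts.  With [E t = expR (- z * cosh t)], the function
[F t = sinh (2 t) * E t] vanishes at both ends of the half-line, and
[sinh (2 t) * sinh t = cosh (3 t) - cosh (2 t) * cosh t] turns the vanishing of
the integral of its derivative into the stated relation. *)
Lemma besselK_recurrence z : 0 < z ->
  @laplace R _ _ mu `[0, +oo[%classic (@cosh R) (fun t => cosh (2 * t) * cosh t) z =
  besselK 3 z - 2 / z * besselK 2 z.
Proof.
move=> z0.
pose E t := expR (- z * cosh t).
have dE t : is_derive t 1 E (- z * sinh t * E t).
  have := cosh_is_derive t => dc.
  by rewrite /E; apply: is_derive_eq; rewrite /GRing.scale/=; ring.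
pose F t := 2 * sinh t * cosh t * E t.
pose f t := 2 * (cosh (2 * t) * E t)
  - z * (cosh (3 * t) * E t - cosh (2 * t) * cosh t * E t).
have fE t : f t = ((4 * cosh t ^+ 2 - 2) - z * (2 * cosh t ^+ 3 - 2 * cosh t)) * E t.
  by rewrite /f cosh_double cosh_triple; ring.
have dF t : is_derive t 1 F (f t).
  have := cosh_is_derive t => dc; have := sinh_is_derive t => ds; have := dE t => dEt.
  rewrite /F fE; apply: is_derive_eq; rewrite /GRing.scale/=.
  have := cosh2_sinh2 t; set s := sinh t; set c := cosh t; set e := E t => cs.
  have -> : 4 * c ^+ 2 - 2 = 2 * c ^+ 2 + 2 * s ^+ 2 by lra.
  have -> : 2 * c ^+ 3 - 2 * c = 2 * c * s ^+ 2.
    by rewrite -[2 * c in LHS]mulr1 -cs; ring.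
  ring.
have cf : continuous f.
  apply: (@is_derive_continuous _ _ (fun t => 'D_1 f t)) => t.
  have dc := cosh_is_derive t; have dEt := dE t.
  rewrite (funext fE : f = _); apply: derivableP; exact: ex_derive.
(* Both [F] and [f] are [E] times a function bounded by this multiple of
   [cosh t ^+ 3]. *)
have bound t (a : R) : 0 <= t -> `|a| <= (4 + 2 * z) * cosh t ^+ 3 ->
    `|a * E t| <= (4 + 2 * z) * (3.+1`!%:R / z ^+ 3.+1 * 2) * expR (- t).
  move=> t0 ab; rewrite normrM [X in _ * X]ger0_norm ?expR_ge0//.
  apply: (le_trans (ler_wpM2r (expR_ge0 _) ab)); rewrite -!mulrA ler_wpM2l//; first lra.
  by have := cosh_expR_le 3 z0 t0; rewrite -!mulrA.
have cs t : `|sinh t| <= cosh t.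
  have := cosh2_sinh2 t; have := cosh_ge1 t => c1 c2s2.
  by rewrite ler_norml; apply/andP; split; nra.
have : \int[mu]_(t in `[0, +oo[) f t = - F 0.
  apply: (integral_is_derive_halfline
    (C := (4 + 2 * z) * (3.+1`!%:R / z ^+ 3.+1 * 2))) => //.
- move=> t t0; rewrite /F; apply: bound => //.
  have c1 := cosh_ge1 t.
  rewrite normrM (normrM 2) (ger0_norm (_ : 0 <= cosh t)); last lra.
  rewrite (ger0_norm (ler0n _ 2)); have := cs t.
  set s := `|_|; set c := cosh t in c1 * => sc.
  have : c ^+ 2 <= c ^+ 3 by rewrite exprS ler_peMl// sqr_ge0.
  have : s * c <= c ^+ 2 by rewrite expr2 ler_wpM2r//; lra.
  have : 0 <= c ^+ 3 by rewrite exprn_ge0//; lra.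
  have : 0 <= z * c ^+ 3 by rewrite mulr_ge0 ?exprn_ge0//; lra.
  lra.
- move=> t t0; rewrite fE; apply: bound => //.
  have c1 := cosh_ge1 t; set c := cosh t in c1 *.
  have c2 : 1 <= c ^+ 2 by rewrite exprn_ege1.
  have c23 : c ^+ 2 <= c ^+ 3 by rewrite exprS ler_peMl// sqr_ge0.
  have c3 : c <= c ^+ 3 by rewrite exprS ler_peMr//; lra.
  have : 0 <= z * (c ^+ 3 - c) by rewrite mulr_ge0//; lra.
  have : 0 <= z * c by rewrite mulr_ge0//; lra.
  by rewrite ler_norml => *; apply/andP; split; lra.
have i2 := cosh2_laplace_integrable z0; have i3 := cosh3_laplace_integrable z0.
have i21 := cosh2M_laplace_integrable z0.
have iZ (a : R) (g : R -> R) : mu.-integrable `[0, +oo[ (EFin \o g) ->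
    mu.-integrable `[0, +oo[ (EFin \o (fun t => a * g t)).
  move=> ig; rewrite (_ : EFin \o _ = (fun t => a%:E * (EFin \o g) t)%E)//.
  exact: integrableZl.
have iB : mu.-integrable `[0, +oo[ (EFin \o (fun t =>
    cosh (3 * t) * E t - cosh (2 * t) * cosh t * E t)).
  rewrite (_ : EFin \o _ = (EFin \o (fun t => cosh (3 * t) * E t)%R) \-
    (EFin \o (fun t => cosh (2 * t) * cosh t * E t)%R))%E//.
  exact: integrableB.
rewrite /F {1}/sinh oppr0 subrr mul0r mulr0 !mul0r oppr0 /f.
rewrite RintegralB//; [|exact: iZ..].
rewrite !RintegralZl// RintegralB// => /eqP; rewrite subr_eq0 => /eqP H.
rewrite !besselK_laplace /laplace -/E.
apply: (mulfI (lt0r_neq0 z0)); rewrite mulrBr mulrA mulrCA divff ?gt_eqF// mulr1 H.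
ring.
Qed.

Lemma besselK2_is_derive z : 0 < z ->
  is_derive z 1 (@besselK R 2) (2 / z * besselK 2 z - besselK 3 z).
Proof.
move=> z0; apply: is_derive_eq.
  apply: laplace_is_derive cosh2_laplace_integrable z0 => //; first exact: cosh_measurable.
  by move=> t _; rewrite (le_trans _ (cosh_ge1 t)).
by rewrite besselK_recurrence// opprB.
Qed.

End BesselDerivative.

(** * The moments of the weight *)

Section WeightMoments.
Context {R : realType}.
Local Notation mu := (@lebesgue_measure R).
Implicit Types (l n : nat) (x z : R) (p : {poly R}).

Definition weight l x : R := (x ^+ 2 - 1) `^ (l%:R + 2^-1).

Definition normalization l z : R := z / ((2 * l%:R + 1) * besselK 2 z).

Definition omega_moment l z n : R := normalization l z *
  @laplace R _ _ mu `[1, +oo[%classic id (fun x => x ^+ n * weight l x) z.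

Lemma weight_le l x : 1 <= x -> `|weight l x| <= x ^+ (2 * l.+1).
Proof.
move=> x1; rewrite ger0_norm ?powR_ge0// exprM -powR_mulrn ?sqr_ge0//.
apply: (@le_trans _ _ ((x ^+ 2) `^ (l%:R + 2^-1))).
  rewrite ge0_ler_powR ?nnegrE ?sqr_ge0//.
  - by rewrite subr_ge0 exprn_ege1.
  - by rewrite gerBl.
rewrite ler_powR ?exprn_ege1// -[l.+1%:R]natr1 lerD2l invf_le1//.
by rewrite ler1n.
Qed.

Lemma weight_laplace_integrable l n :
  @laplace_integrable R _ _ mu `[1, +oo[%classic id (fun x => x ^+ n * weight l x).
Proof.
have l1 : @laplace_integrable R _ _ mu `[1, +oo[%classic id
    (fun x => 1 * x ^+ (n + 2 * l.+1)).
  apply: laplace_integrableX (laplace_integrable1 ler01) => //.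
  by move=> x; rewrite /= in_itv/= andbT => /(le_trans ler01).
apply: (laplace_integrable_le (a := 1) _ _ _ _ l1) => //.
  apply: measurable_funM; first exact: exprn_measurable.
  rewrite /weight.
  apply: (measurableT_comp (@measurable_powR R _)).
  by apply: measurable_funB => //; exact: exprn_measurable.
move=> x; rewrite /= in_itv/= andbT => x1.
rewrite !mul1r exprD !normrM ler_wpM2l// (le_trans (weight_le l x1))//.
exact: ler_norm.
Qed.

Lemma normalization_is_derive l z : 0 < z -> besselK 2 z != 0 ->
  is_derive z 1 (normalization l) (normalization l z * (besselG z - z^-1)).
Proof.
move=> z0 K0; have z_neq0 : z != 0 by rewrite gt_eqF.
have dK := besselK2_is_derive z0.
have l0 : 2 * l%:R + 1 != 0 :> R by rewrite gt_eqF// ltr_wpDl// mulr_ge0.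
have dK' : is_derive z 1 (fun s => (2 * l%:R + 1) * besselK 2 s)
  ((2 * l%:R + 1) * (2 / z * besselK 2 z - besselK 3 z)) by exact: is_deriveZ.
have D0 : (2 * l%:R + 1) * besselK 2 z != 0 by rewrite mulf_neq0.
have dV := is_deriveV (f := fun s => (2 * l%:R + 1) * besselK 2 s) D0 dK'.
apply: is_derive_eq (is_deriveM (is_derive_id _ _) dV) _.
rewrite /GRing.scale/= /normalization /besselG; field.
by rewrite z_neq0 K0 l0.
Qed.

(** The normalization contributes the factor [g z] and the exponential the
shifted moment, with a minus sign. *)
Lemma omega_moment_is_derive l z n : 0 < z -> besselK 2 z != 0 ->
  is_derive z 1 (omega_moment l ^~ n)
    ((besselG z - z^-1) * omega_moment l z n - omega_moment l z n.+1).
Proof.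
move=> z0 K0; have dN := normalization_is_derive l z0 K0.
have dL : is_derive z 1
    (@laplace R _ _ mu `[1, +oo[%classic id (fun x => x ^+ n * weight l x))
    (- @laplace R _ _ mu `[1, +oo[%classic id (fun x => x ^+ n * weight l x * x) z).
  apply: (laplace_is_derive _ _ _ (weight_laplace_integrable l n)) => //.
  by move=> x; rewrite /= in_itv/= andbT => /(le_trans ler01).
apply: is_derive_eq (is_deriveM dN dL) _.
rewrite /GRing.scale/= /omega_moment.
rewrite (_ : (fun x => x ^+ n.+1 * weight l x) = (fun x => x ^+ n * weight l x * x)).
  ring.
by apply/funext => x; rewrite exprSr mulrAC.
Qed.

Lemma omega_dot_moment l z (f g : R -> R) p : 0 < z ->
  (forall x, f x * g x = p.[x]) ->
  omega_dot l z f g = moment_functional (omega_moment l z) p.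
Proof.
move=> z0 fg.
have iw n : mu.-integrable `[1, +oo[ (EFin \o (fun x : R =>
    x ^+ n * weight l x * expR (- z * x))) := weight_laplace_integrable l n z0.
have sumE m (c : nat -> R) : mu.-integrable `[1, +oo[ (EFin \o (fun x : R =>
      \sum_(i < m) c i * (x ^+ i * weight l x * expR (- z * x)))) /\
    \int[mu]_(x in `[1, +oo[)
      (\sum_(i < m) c i * (x ^+ i * weight l x * expR (- z * x))) =
    \sum_(i < m) c i *
      \int[mu]_(x in `[1, +oo[) (x ^+ i * weight l x * expR (- z * x)).
  have iZ (a : R) (h : R -> R) : mu.-integrable `[1, +oo[ (EFin \o h) ->
      mu.-integrable `[1, +oo[ (EFin \o (fun x => a * h x)).
    move=> ih; rewrite (_ : EFin \o _ = (fun t => a%:E * (EFin \o h) t)%E)//.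
    exact: integrableZl.
  elim: m => [|m [IHi IHs]].
    split; last by under eq_Rintegral do rewrite big_ord0; rewrite big_ord0 Rintegral_cst// mul0r.
    rewrite (_ : EFin \o _ = cst 0%E); first exact: integrable0.
    by apply/funext => x /=; rewrite big_ord0.
  have sE x : \sum_(i < m.+1) c i * (x ^+ i * weight l x * expR (- z * x)) =
      \sum_(i < m) c i * (x ^+ i * weight l x * expR (- z * x)) +
      c m * (x ^+ m * weight l x * expR (- z * x)) by rewrite big_ord_recr.
  split.
    rewrite (_ : EFin \o _ = (EFin \o (fun x : R =>
      \sum_(i < m) c i * (x ^+ i * weight l x * expR (- z * x)))%R) \+
      (EFin \o (fun x : R => c m * (x ^+ m * weight l x * expR (- z * x)))%R))%E; last first.
      by apply/funext => x /=; rewrite big_ord_recr.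
    by apply: integrableD => //; exact: iZ.
  under eq_Rintegral do rewrite sE.
  by rewrite RintegralD// ?RintegralZl// ?IHs ?big_ord_recr//; exact: iZ.
have [_] := sumE (size p) (fun i => p`_i * normalization l z).
rewrite /omega_dot /moment_functional => H.
transitivity (\sum_(i < size p) p`_i * normalization l z *
  \int[mu]_(x in `[1, +oo[) (x ^+ i * weight l x * expR (- z * x))); last first.
  by apply: eq_bigr => i _; rewrite -mulrA.
rewrite -H; apply: eq_Rintegral => x _.
rewrite fg horner_coef mulr_suml; apply: eq_bigr => i _.
by rewrite /omega -/(weight l x) /normalization; ring.
Qed.

End WeightMoments.

(** * The parameter derivative of the orthonormal polynomials *)

Theorem theorem3p3 (R : realType) (P : nat -> R -> nat -> {poly R})
    (hP : forall (l : nat) (z : R), 0 < z -> orthonormal_polys l z (P l z)) :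
  forall (l k : nat) (z : R), 0 < z -> forall x : R,
    is_derive z 1 (fun s : R => (P l s k.+1).[x])
      (coef_a P l z k * (P l z k).[x]
       - 2^-1 * (besselG z - z^-1 - coef_b P l z k.+1) * (P l z k.+1).[x]).
Proof.
move=> l k z z0 x.
(* Were [besselK 2 s] zero, the weight would vanish identically, and [P l s 0]
   could not have norm one. *)
have K0 (s : R) : 0 < s -> besselK 2 s != 0.
  move=> s0; apply/eqP => Ks; have [_ _ /(_ 0%N 0%N)/eqP] := hP l s s0.
  rewrite /omega_dot; under eq_Rintegral do rewrite /omega Ks mulr0 invr0 mulr0 mul0r mulr0.
  by rewrite Rintegral_cst// mul0r eq_sym oner_eq0.
have dm (s : R) : 0 < s -> forall i, is_derive s 1 (omega_moment l ^~ i)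
    ((besselG s - s^-1) * omega_moment l s i - omega_moment l s i.+1).
  by move=> s0 i; apply: omega_moment_is_derive => //; exact: K0.
have oP (s : R) : 0 < s -> orthonormal_family (moment_functional (omega_moment l s)) (P l s).
  move=> s0; have [sP lP LP] := hP l s s0; split=> // i j.
  by rewrite -LP (@omega_dot_moment _ _ _ _ _ (P l s i * P l s j))// => y; rewrite hornerM.
have := poly_is_derive_horner x (orthonormal_poly_flow dm oP k z0).
rewrite hornerD hornerN !hornerZ.
rewrite /coef_a (@omega_dot_moment _ _ _ _ _ ('X * P l z k * P l z k.+1))//; last first.
  by move=> y; rewrite !hornerM hornerX.
rewrite /coef_b (@omega_dot_moment _ _ _ _ _ ('X * P l z k.+1 * P l z k.+1))//.
by move=> y; rewrite !hornerM hornerX.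
Qed.
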